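(* D-Frege+$\forall$red is a sound refutational proof system: if an S-form DQBF has a D-Frege+$\forall$red refutation, then it is false.
   Context: An S-form DQBF is a formula $\forall U\exists E\,\phi$ where $U$ is a finite set of universal variables, $E$ a finite set of existential variables, each $x\in E$ carries a dependency set $D_x\subseteq U$, and $\phi$ is a quantifier-free propositional formula over $U\cup E$. For a universal variable $u$ set $D_u=\{u\}$. The DQBF is true iff there are functions $f_x:\{0,1\}^{D_x}\to\{0,1\}$ ($x\in E$) such that for every assignment $\tau$ to $U$, $\tau$ extended by $x\mapsto f_x(\tau|_{D_x})$ satisfies $\phi$; otherwise it is false. D-Frege+$\forall$red: a refutation of $\forall U\exists E\,\phi$ is a sequence of propositional formulas ending in the constant $0$, each obtained by one of: (Frege) an axiom or rule of a fixed Frege system (finite, sound, implicationally complete set of schematic propositional axioms and rules) applied to earlier lines; (Axiom) a conjunct of $\phi$; (IndExt) a formula $\alpha\to(v\leftrightarrow\bigwedge_{y\in Y}y)$ or $\alpha\to(v\leftrightarrow\bigvee_{y\in Y}y)$, where $\alpha$ is a conjunction of universal literals, $Y$ a set of literals of existing variables, and $v$ a fresh variable added as existential with $D_v=(\bigcup_{y\in Y}D_{\mathrm{var}(y)})\setminus\mathrm{var}(\alpha)$; ($\forall$-red) from an earlier line $L(u)$ derive $L(0)$ or $L(1)$, where $u$ is universal and no existential variable $x$ occurring in $L$ has $u\in D_x$; (prefix weakening) the prefix may be extended by a new variable not occurring in the matrix. *)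

(* Defs.v *)
From HB Require Import structures.
From mathcomp Require Import all_boot finmap.

Set Implicit Arguments.
Unset Strict Implicit.
Unset Printing Implicit Defensive.

Local Open Scope fset_scope.
Local Open Scope fmap_scope.

(* Propositional variables are natural numbers. *)
Inductive form :=
  | Bot
  | Top
  | Var of nat
  | Neg of form
  | And of form & form
  | Or of form & form
  | Imp of form & form
  | Iff of form & form.

Lemma form_comparable : comparable form.
Proof. by move=> A B; rewrite /decidable; do 2! decide equality. Qed.

HB.instance Definition _ := hasDecEq.Build form (compareP form_comparable).

Fixpoint eval (t : nat -> bool) (A : form) : bool :=
  match A with
  | Bot => false
  | Top => true
  | Var x => t x
  | Neg B => ~~ eval t B
  | And B C => eval t B && eval t C
  | Or B C => eval t B || eval t C
  | Imp B C => eval t B ==> eval t C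
  | Iff B C => eval t B == eval t C
  end.

Fixpoint vars (A : form) : {fset nat} :=
  match A with
  | Bot | Top => fset0
  | Var x => [fset x]
  | Neg B => vars B
  | And B C | Or B C | Imp B C | Iff B C => vars B `|` vars C
  end.

Fixpoint subst (s : nat -> form) (A : form) : form :=
  match A with
  | Bot => Bot
  | Top => Top
  | Var x => s x
  | Neg B => Neg (subst s B)
  | And B C => And (subst s B) (subst s C)
  | Or B C => Or (subst s B) (subst s C)
  | Imp B C => Imp (subst s B) (subst s C)
  | Iff B C => Iff (subst s B) (subst s C)
  end.

Definition subst1 (u : nat) (B : form) : form -> form :=
  subst (fun x => if x == u then B else Var x).

(* A is regarded as a conjunction bracketed in any way; a formula whose main
   connective is not a conjunction is its own only conjunct. *)
Fixpoint conjuncts (A : form) : seq form :=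
  if A is And B C then conjuncts B ++ conjuncts C else [:: A].

Fixpoint bigAnd (s : seq form) : form :=
  match s with
  | [::] => Top
  | [:: A] => A
  | A :: s' => And A (bigAnd s')
  end.

Fixpoint bigOr (s : seq form) : form :=
  match s with
  | [::] => Bot
  | [:: A] => A
  | A :: s' => Or A (bigOr s')
  end.

(* (x, true) is the literal x, and (x, false) is its negation. *)
Definition lit := (nat * bool)%type.

Definition lit_var (l : lit) : nat := l.1.

Definition lit_form (l : lit) : form :=
  if l.2 then Var l.1 else Neg (Var l.1).

(* A rule is a pair (premises, conclusion) in which the variables are schematic:
   an instance is obtained by substituting formulas for them.  An axiom scheme
   is a rule without premises. *)
Definition rule := (seq form * form)%type.

Definition frege_rules := seq rule.

Definition entails (G : seq form) (A : form) : Prop :=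
  forall t : nat -> bool, all (eval t) G -> eval t A.

Definition frege_step (F : frege_rules) (L : seq form) (A : form) : Prop :=
  exists2 r : rule, r \in F &
  exists2 s : nat -> form,
    {in r.1, forall B, subst s B \in L} & A = subst s r.2.

Inductive frege_derivation (F : frege_rules) (G : seq form) :
    seq form -> Prop :=
  | FregeNil : frege_derivation F G [::]
  | FregeHyp L A :
      frege_derivation F G L -> A \in G -> frege_derivation F G (rcons L A)
  | FregeRule L A :
      frege_derivation F G L -> frege_step F L A ->
      frege_derivation F G (rcons L A).

Definition frege_derivable (F : frege_rules) (G : seq form) (A : form) : Prop :=
  exists L, frege_derivation F G (rcons L A).

Definition frege_sound (F : frege_rules) : Prop :=
  {in F, forall r, entails r.1 r.2}.

Definition implicationally_complete (F : frege_rules) : Prop :=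
  forall G A, entails G A -> frege_derivable F G A.

Definition frege_system (F : frege_rules) : Prop :=
  frege_sound F /\ implicationally_complete F.

(* The set of existential variables is the domain of the finite map [deps],
   which sends each of them to its dependency set. *)
Record qprefix := QPrefix {
  univ : {fset nat};
  deps : {fmap nat -> {fset nat}}
}.

Definition exis (P : qprefix) : {fset nat} := domf (deps P).

Definition declared (P : qprefix) : {fset nat} := univ P `|` exis P.

(* The value fset0 for undeclared variables is never used. *)
Definition depset (P : qprefix) (x : nat) : {fset nat} :=
  if x \in univ P then [fset x] else odflt fset0 (deps P).[? x].

Definition add_univ (P : qprefix) (u : nat) : qprefix :=
  QPrefix (u |` univ P) (deps P).

Definition add_exis (P : qprefix) (x : nat) (D : {fset nat}) : qprefix :=
  QPrefix (univ P) (deps P).[x <- D].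

Record dqbf := DQBF {
  pfx : qprefix;
  matrix : form
}.

Definition wf_dqbf (Q : dqbf) : Prop :=
  [/\ [disjoint univ (pfx Q) & exis (pfx Q)],
      forall x : exis (pfx Q), deps (pfx Q) x `<=` univ (pfx Q)
    & vars (matrix Q) `<=` declared (pfx Q)].

Definition skolem (P : qprefix) : Type :=
  forall x : exis P, {ffun deps P x -> bool} -> bool.

(* The value false outside U is irrelevant to a well-formed DQBF. *)
Definition total_of (U : {fset nat}) (t : {ffun U -> bool}) (x : nat) : bool :=
  if insub x is Some u then t u else false.

Definition restrict (D : {fset nat}) (t : nat -> bool) : {ffun D -> bool} :=
  [ffun x : D => t (val x)].

Definition extend (P : qprefix) (f : skolem P) (t : {ffun univ P -> bool})
    (x : nat) : bool :=
  if insub x is Some e then f e (restrict (deps P e) (total_of t))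
  else total_of t x.

Definition dqbf_true (Q : dqbf) : Prop :=
  exists f : skolem (pfx Q),
  forall t : {ffun univ (pfx Q) -> bool}, eval (extend f t) (matrix Q).

Definition dqbf_false (Q : dqbf) : Prop := ~ dqbf_true Q.

Definition ext_fresh (P : qprefix) (L : seq form) (v : nat) : Prop :=
  v \notin declared P /\ {in L, forall A, v \notin vars A}.

Definition ext_deps (P : qprefix) (alpha Y : seq lit) : {fset nat} :=
  (\bigcup_(y <- Y) depset P (lit_var y))
    `\` [fset x in map lit_var alpha].

Definition ext_and (alpha : seq lit) (v : nat) (Y : seq lit) : form :=
  Imp (bigAnd (map lit_form alpha)) (Iff (Var v) (bigAnd (map lit_form Y))).

Definition ext_or (alpha : seq lit) (v : nat) (Y : seq lit) : form :=
  Imp (bigAnd (map lit_form alpha)) (Iff (Var v) (bigOr (map lit_form Y))).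

(* [derivation F Q P L]: the lines L, in order, have been derived from Q, and the
   prefix has grown from [pfx Q] to P.  Sets of literals are given by a
   repetition-free enumeration.  Frege instances may mention undeclared
   variables. *)
Inductive derivation (F : frege_rules) (Q : dqbf) : qprefix -> seq form -> Prop :=
  | DNil : derivation F Q (pfx Q) [::]
  | DFrege P L A :
      derivation F Q P L ->
      frege_step F L A ->
      derivation F Q P (rcons L A)
  | DAxiom P L A :
      derivation F Q P L ->
      A \in conjuncts (matrix Q) ->
      derivation F Q P (rcons L A)
  | DIndExtAnd P L (alpha Y : seq lit) v :
      derivation F Q P L ->
      {in alpha, forall l, lit_var l \in univ P} ->
      uniq Y -> {in Y, forall y, lit_var y \in declared P} ->
      ext_fresh P L v ->
      derivation F Q (add_exis P v (ext_deps P alpha Y))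
                     (rcons L (ext_and alpha v Y))
  | DIndExtOr P L (alpha Y : seq lit) v :
      derivation F Q P L ->
      {in alpha, forall l, lit_var l \in univ P} ->
      uniq Y -> {in Y, forall y, lit_var y \in declared P} ->
      ext_fresh P L v ->
      derivation F Q (add_exis P v (ext_deps P alpha Y))
                     (rcons L (ext_or alpha v Y))
  | DRed P L A u (b : bool) :
      derivation F Q P L ->
      A \in L ->
      u \in univ P ->
      {in vars A, forall x, x \in exis P -> u \notin depset P x} ->
      derivation F Q P (rcons L (subst1 u (if b then Top else Bot) A))
  | DWeakUniv P L u :
      derivation F Q P L ->
      u \notin declared P -> u \notin vars (matrix Q) ->
      derivation F Q (add_univ P u) L
  | DWeakExis P L x (D : {fset nat}) :
      derivation F Q P L ->
      x \notin declared P -> x \notin vars (matrix Q) ->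
      D `<=` univ P ->
      derivation F Q (add_exis P x D) L.

Definition refutable (F : frege_rules) (Q : dqbf) : Prop :=
  exists P L, derivation F Q P (rcons L Bot).

(* Main.v *)
(* Undeclared variables may occur in the lines of a derivation, so they are
   treated as universal.  A strategy turns an assignment t of all variables into
   one that agrees with t off the existential variables and whose value at an
   existential variable x depends only on t restricted to D_x.  Given a strategy
   satisfying the matrix, each step extends it so that it keeps satisfying the
   matrix and all lines, for every t; hence 0 is never derived.  For
   alpha -> (v <-> B), the value of v is that of B after forcing the variables of
   alpha to the values making alpha true, which removes them from D_v. *)
Require Import Defs.
From mathcomp Require Import all_boot finmap.

Set Implicit Arguments.
Unset Strict Implicit.
Unset Printing Implicit Defensive.

Local Open Scope fset_scope.
Local Open Scope fmap_scope.

Lemma eq_in_eval (t t' : nat -> bool) A :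
  {in vars A, t =1 t'} -> eval t A = eval t' A.
Proof.
elim: A => //= [x|A IH|A IHA B IHB|A IHA B IHB|A IHA B IHB|A IHA B IHB] tt'.
- by apply: tt'; rewrite inE.
- by rewrite IH.
all: rewrite IHA ?IHB // => x xAB; apply: tt'; by rewrite inE xAB ?orbT.
Qed.

Lemma eval_subst t s A : eval t (subst s A) = eval (fun x => eval t (s x)) A.
Proof. by elim: A => //= [A ->|A -> B ->|A -> B ->|A -> B ->|A -> B ->]. Qed.

Lemma eval_conjuncts t A : eval t A = all (eval t) (conjuncts A).
Proof.
by elim: A => //= [x|A _|A -> B ->|A _ B _|A _ B _|A _ B _];
  rewrite ?all_cat ?andbT.
Qed.

Lemma eval_bigAnd t s : eval t (bigAnd s) = all (eval t) s.
Proof. by elim: s => //= A [|B s] /= IH; rewrite ?andbT // IH. Qed.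

Lemma vars_bigAnd x s :
  x \in vars (bigAnd s) -> exists2 A, A \in s & x \in vars A.
Proof.
elim: s => //= A [|B s] IH; first by exists A; rewrite ?mem_head.
rewrite inE => /orP[xA|/IH[C Cs xC]]; first by exists A; rewrite ?mem_head.
by exists C; rewrite // inE Cs orbT.
Qed.

Lemma vars_bigOr x s :
  x \in vars (bigOr s) -> exists2 A, A \in s & x \in vars A.
Proof.
elim: s => //= A [|B s] IH; first by exists A; rewrite ?mem_head.
rewrite inE => /orP[xA|/IH[C Cs xC]]; first by exists A; rewrite ?mem_head.
by exists C; rewrite // inE Cs orbT.
Qed.

Lemma vars_lit_form l : vars (lit_form l) = [fset lit_var l].
Proof. by case: l => x []. Qed.

Lemma eval_lit_form t l : eval t (lit_form l) = (t (lit_var l) == l.2).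
Proof. by case: l => x [] /=; rewrite /lit_var /=; case: (t x). Qed.

Lemma frege_step_sound F L A t :
  frege_sound F -> frege_step F L A ->
  {in L, forall B, eval t B} -> eval t A.
Proof.
move=> soundF [r rF [s sL ->]] tL; rewrite eval_subst.
apply: (soundF r rF); apply/allP => B Br.
by rewrite -eval_subst; apply/tL/sL.
Qed.

Lemma exis_add_exis P v D : exis (add_exis P v D) = v |` exis P.
Proof. exact: dom_setf. Qed.

Lemma depset_add_exis P v D x :
  v \notin univ P -> depset (add_exis P v D) x = if x == v then D else depset P x.
Proof.
move=> vU; rewrite /depset /= fnd_set.
by case: eqVneq => [->|//]; rewrite (negbTE vU).
Qed.

Definition upd (t : nat -> bool) (u : nat) (b : bool) : nat -> bool :=
  fun x => if x == u then b else t x.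

Definition strategy (P : qprefix) (e : (nat -> bool) -> nat -> bool) : Prop :=
  (forall t x, x \notin exis P -> e t x = t x) /\
  (forall t t' x, x \in exis P -> {in depset P x, t =1 t'} -> e t x = e t' x).

(** The dependence clause of [strategy] extends to universal variables: there [depset P x] is the
    singleton of [x], and [e] leaves [x] unchanged. *)
Lemma strategy_declared P e t t' x :
  strategy P e -> x \in declared P -> {in depset P x, t =1 t'} ->
  e t x = e t' x.
Proof.
move=> [eU eE] xP tt'; have [xE|xE] := boolP (x \in exis P); first exact: eE.
rewrite !eU //; apply: tt'.
by move: xP; rewrite /depset inE (negbTE xE) orbF => ->; rewrite inE.
Qed.

Lemma strategy_of_skolem Q (f : skolem (pfx Q)) :
  wf_dqbf Q ->
  (forall t : {ffun univ (pfx Q) -> bool}, eval (extend f t) (matrix Q)) ->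
  exists2 e, strategy (pfx Q) e & forall t, eval (e t) (matrix Q).
Proof.
move=> [dUE DU vQ] fQ.
pose e (t : nat -> bool) x :=
  if insub x is Some y then f y (restrict (deps (pfx Q) y) t) else t x.
exists e; first split=> [t x xE|t t' x xE tt'].
- by rewrite /e insubN.
- rewrite /e (insubT (mem (exis (pfx Q))) xE); congr (f _ _).
  apply/ffunP => y; rewrite !ffunE; apply: tt'.
  (* Disjointness of the prefix rules out the universal branch of [depset], so [depset] at [x]
     really is its entry in [deps]. *)
  rewrite /depset ifN; last by apply: contraL (xE) => xU; apply: (fdisjointP dUE).
  by rewrite in_fnd; apply: valP.
move=> t; rewrite (eq_in_eval (t' := extend f (restrict (univ (pfx Q)) t))) //.
(* The default [false] of [total_of] is never read: dependency sets lie in the universal set, and a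
   variable of the matrix that is not existential is universal. *)
have tot y : y \in univ (pfx Q) -> total_of (restrict (univ (pfx Q)) t) y = t y.
  by move=> yU; rewrite /total_of (insubT (mem (univ (pfx Q))) yU) ffunE.
move=> x /(fsubsetP vQ) xQ; rewrite /e /extend; case: insubP => [y _ _|xE].
  congr (f _ _); apply/ffunP => z; rewrite !ffunE tot //.
  by apply: (fsubsetP (DU y)); apply: valP.
by rewrite tot //; move: xQ; rewrite inE (negbTE xE) orbF.
Qed.

Definition sat_lines (e : (nat -> bool) -> nat -> bool) (L : seq form) : Prop :=
  forall t, {in L, forall A, eval (e t) A}.

Lemma sat_lines_rcons e M L A :
  sat_lines e (M :: L) -> (forall t, eval (e t) A) ->
  sat_lines e (M :: rcons L A).
Proof.
move=> eL eA t B; rewrite -rcons_cons mem_rcons inE => /predU1P[->|] //.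
exact: eL.
Qed.

(** A variable occurring in [alpha] with both signs is set to true. The choice is harmless, since
    the forced assignment has to match the original one only where [alpha] holds. *)
Definition force (alpha : seq lit) (t : nat -> bool) (x : nat) : bool :=
  if x \in map lit_var alpha then (x, true) \in alpha else t x.

Lemma force_id alpha t :
  {in alpha, forall l, t (lit_var l) = l.2} -> force alpha t =1 t.
Proof.
move=> t_alpha x; rewrite /force; case: ifP => // /mapP[[y b] la /= ->].
have /= ty := t_alpha _ la; rewrite /lit_var /= in ty *.
apply/idP/idP => [/t_alpha //|tyT].
by rewrite -tyT ty.
Qed.

(** Where [alpha] holds, forcing it changes nothing, so [v] takes the value of [B]; elsewhere the
    implication is vacuous. The formula [B] stands for the conjunction or the disjunction of [Y]. *)
Lemma ind_ext_strategy P e M L alpha Y v B :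
  strategy P e -> sat_lines e (M :: L) -> vars M `<=` declared P ->
  {in alpha, forall l, lit_var l \in univ P} -> [disjoint univ P & exis P] ->
  {in Y, forall y, lit_var y \in declared P} -> ext_fresh P L v ->
  {in vars B, forall x, x \in map lit_var Y} ->
  exists2 e', strategy (add_exis P v (ext_deps P alpha Y)) e' &
    sat_lines e'
      (M :: rcons L (Imp (bigAnd (map lit_form alpha)) (Iff (Var v) B))).
Proof.
move=> eP eL vM alphaU dUE YP [vP vL] vB; have [eU eE] := eP.
have vU : v \notin univ P by apply: contra vP; rewrite inE => ->.
have vE : v \notin exis P by apply: contra vP; rewrite inE orbC => ->.
have BP x : x \in vars B -> x \in declared P.
  by move=> /vB/mapP[y yY ->]; apply: YP.
pose e' t x := if x == v then eval (e (force alpha t)) B else e t x.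
have e'e t A : v \notin vars A -> eval (e' t) A = eval (e t) A.
  move=> vA; apply: eq_in_eval => x xA; rewrite /e' ifN //.
  by apply: contraNneq vA => <-.
exists e'; first split=> [t x|t t' x].
- by rewrite exis_add_exis !inE negb_or /e' => /andP[/negbTE -> /eU].
- rewrite exis_add_exis depset_add_exis // !inE /e'.
  case: eqVneq => [_ _ tt'|_ /= xE]; last exact: eE.
  apply: eq_in_eval => y yB; apply: (strategy_declared eP (BP _ yB)) => z zy.
  (* A variable of [alpha] gets the same constant from [t] and [t']; any other [z] survives the set
     difference in [ext_deps]. *)
  rewrite /force; case: ifP => // za; apply: tt'.
  rewrite !inE za /=; have /mapP[l lY yl] := vB _ yB.
  by apply/bigfcupP; exists l; rewrite ?lY // -yl.
apply: sat_lines_rcons => [t A|t].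
  rewrite inE => AL; rewrite e'e; first exact: eL.
  case/predU1P: AL => [->|/vL //]; by apply: contra vP => /(fsubsetP vM).
rewrite /= eval_bigAnd; apply/implyP => /allP ta.
rewrite e'e; last by apply: contra vP => /BP.
rewrite {1}/e' eqxx; apply/eqP/eq_in_eval => x xB.
apply: (strategy_declared eP (BP _ xB)) => y _; apply: force_id => l la.
(* The variables of [alpha] are universal and differ from [v], so [e'] keeps their values and
   [alpha] is true under [t] itself. *)
have lE : lit_var l \notin exis P by apply: (fdisjointP dUE); apply: alphaU.
have := ta _ (map_f _ la); rewrite eval_lit_form => /eqP <-.
rewrite /e' ifN ?eU //; apply: contraNneq vU => <-; exact: alphaU.
Qed.

(** Substituting a constant for [u] amounts to evaluating [A] at [upd t u b]: no existential
    variable of [A] reacts to the change, and [A] holds for every assignment. *)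
Lemma red_sound P e A u b :
  strategy P e -> u \in univ P -> [disjoint univ P & exis P] ->
  {in vars A, forall x, x \in exis P -> u \notin depset P x} ->
  (forall t, eval (e t) A) ->
  forall t, eval (e t) (subst1 u (if b then Top else Bot) A).
Proof.
move=> [eU eE] uU dUE uA eA t; rewrite eval_subst -(@eq_in_eval (e (upd t u b))) //.
move=> x xA; have [xE|xE] := boolP (x \in exis P).
  rewrite ifN; last by apply: contraTneq xE => ->; apply: (fdisjointP dUE).
  apply: eE => // y yx; rewrite /upd ifN //.
  by apply: contraTneq yx => ->; apply: uA.
rewrite eU // /upd; case: eqP => _; first by case: b.
by rewrite /= eU.
Qed.

(** Lines may already mention [x], read as universal so far. They hold for every assignment, hence
    also with [x] fixed to false, and a constant respects any [D]. *)
Lemma weak_exis_strategy P e L x D :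
  strategy P e -> sat_lines e L -> x \notin declared P ->
  exists2 e', strategy (add_exis P x D) e' & sat_lines e' L.
Proof.
rewrite inE negb_or => -[eU eE] eL /andP[xU xE].
exists (fun t => e (upd t x false)); last by move=> t; apply: eL.
split=> [t y|t t' y]; rewrite exis_add_exis !inE.
  by rewrite negb_or => /andP[/negbTE yx yE]; rewrite eU // /upd yx.
rewrite depset_add_exis //; case: eqVneq => [-> _ _|_ /= yE tt'].
  by rewrite !eU // /upd eqxx.
by apply: eE => // z zy; rewrite /upd; case: ifP => // _; apply: tt'.
Qed.

(** Disjointness keeps universal variables fixed by strategies; the inclusion ensures that a fresh
    extension variable does not occur in the matrix. *)
Lemma derivation_prefix F Q P L :
  wf_dqbf Q -> derivation F Q P L ->
  [disjoint univ P & exis P] /\ vars (matrix Q) `<=` declared P.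
Proof.
move=> [dUE _ vQ]; have addE P0 v D : v \notin declared P0 ->
    [disjoint univ P0 & exis P0] /\ vars (matrix Q) `<=` declared P0 ->
    [disjoint univ (add_exis P0 v D) & exis (add_exis P0 v D)] /\
    vars (matrix Q) `<=` declared (add_exis P0 v D).
  rewrite inE negb_or => /andP[vU _] [/fdisjointP d /fsubsetP s].
  rewrite /declared exis_add_exis; split.
    apply/fdisjointP => x xU; rewrite !inE negb_or d // andbT.
    by apply: contraNneq vU => <-.
  by apply/fsubsetP => x /s; rewrite !inE => /orP[->|->]; rewrite ?orbT.
elim=> {P L} // [P L alpha Y v _ IH _ _ _ [vP _]|P L alpha Y v _ IH _ _ _ [vP _]
                |P L u _ [/fdisjointP d /fsubsetP s] uP _|P L x D _ IH xP _ _];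
  try exact: addE.
split; last first.
  by apply/fsubsetP => x /s; rewrite !inE => /orP[->|->]; rewrite ?orbT.
move: uP; rewrite inE negb_or => /andP[_ uE].
by apply/fdisjointP => x; rewrite !inE => /predU1P[->|/d].
Qed.

Lemma derivation_sound F Q P L e0 :
  frege_sound F -> wf_dqbf Q -> strategy (pfx Q) e0 ->
  (forall t, eval (e0 t) (matrix Q)) -> derivation F Q P L ->
  exists2 e, strategy P e & sat_lines e (matrix Q :: L).
Proof.
move=> soundF wfQ e0P e0Q.
elim=> {P L} [|P L A _ [e eP eL] stepA|P L A _ [e eP eL] AQ
  |P L alpha Y v dL [e eP eL] alphaU _ YP vF
  |P L alpha Y v dL [e eP eL] alphaU _ YP vF
  |P L A u b dL [e eP eL] AL uU uA|P L u _ [e [eU eE] eL] uP _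
  |P L x D _ [e eP eL] xP _ _].
- by exists e0 => // t A /[!inE] /eqP ->.
- exists e => //; apply: sat_lines_rcons => // t.
  by apply: (frege_step_sound soundF stepA) => B BL; apply: eL; rewrite inE BL orbT.
- exists e => //; apply: sat_lines_rcons => // t.
  have := eL t _ (mem_head _ _); rewrite eval_conjuncts => /allP; exact.
- have [dUE vQ] := derivation_prefix wfQ dL.
  apply: (ind_ext_strategy eP eL) => // x /vars_bigAnd[_ /mapP[l lY ->]].
  by rewrite vars_lit_form inE => /eqP ->; apply: map_f.
- have [dUE vQ] := derivation_prefix wfQ dL.
  apply: (ind_ext_strategy eP eL) => // x /vars_bigOr[_ /mapP[l lY ->]].
  by rewrite vars_lit_form inE => /eqP ->; apply: map_f.
- have [dUE _] := derivation_prefix wfQ dL.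
  exists e => //; apply: sat_lines_rcons => //.
  by apply: (red_sound b eP uU dUE uA) => t; apply: eL; rewrite inE AL orbT.
(* The undeclared [u] was already treated as universal, so [e] still works; an existential [x]
   differs from [u] and keeps its dependency set. *)
- exists e; last exact: eL.
  split=> [t x /eU //|t t' x xE tt']; apply: eE => // y yx; apply: tt'.
  have xu : x != u.
    by apply: contraNneq uP => <-; rewrite inE [_ \in exis P]xE orbT.
  by move: yx; rewrite /depset /= !inE (negbTE xu).
- exact: (weak_exis_strategy _ eP eL).
Qed.

Theorem theorem2 (F : frege_rules) (Q : dqbf)
    (HF : frege_system F) (HQ : wf_dqbf Q) :
  refutable F Q -> dqbf_false Q.
Proof.
move=> [P [L dL]] [f fQ]; have [e0 e0P e0Q] := strategy_of_skolem HQ fQ.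
have [e _ eL] := derivation_sound HF.1 HQ e0P e0Q dL.
by have := eL xpred0 Bot; rewrite -rcons_cons mem_rcons mem_head => /(_ isT).
Qed.
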